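(* Let $\mathcal{G}=(V,E)$ be a connected undirected graph of finite order $N\ge 1$ with polynomial growth constants $d(\mathcal{G})>0$ and $D_1(\mathcal{G})>0$. Let $m\ge 1$ be an integer and, for each $i\in V$, let $f_i:\mathbb{R}^N\to\mathbb{R}$ be continuously differentiable and depend only on the variables $x(j)$, $j\in B(i,m)$, of $\boldsymbol{x}=(x(j))_{j\in V}$. Let $F=\sum_{i\in V} f_i$, and assume there exist constants $0<c<L<\infty$ and positive definite matrices $\mathbf{\Phi}(\boldsymbol{x},\boldsymbol{y})$, $\boldsymbol{x},\boldsymbol{y}\in\mathbb{R}^N$, on $\mathcal{G}$ such that for all $\boldsymbol{x},\boldsymbol{y}\in\mathbb{R}^N$ $$\omega(\mathbf{\Phi}(\boldsymbol{x},\boldsymbol{y}))\le 2m,\qquad c\,\mathbf{I}\preceq \mathbf{\Phi}(\boldsymbol{x},\boldsymbol{y})\preceq L\,\mathbf{I},\qquad \nabla F(\boldsymbol{x})-\nabla F(\boldsymbol{y})=\mathbf{\Phi}(\boldsymbol{x},\boldsymbol{y})(\boldsymbol{x}-\boldsymbol{y}).$$ Let $\hat{\boldsymbol{x}}=\arg\min_{\boldsymbol{x}\in\mathbb{R}^N}F(\boldsymbol{x})$ be the unique minimizer of $F$. Let $R\ge 1$, let $D_\lambda$, $\lambda\in\Lambda$, be governing vertex sets with extended $R$-neighbors $D_{\lambda,R}$, $\lambda\in\Lambda$, and let $\{\boldsymbol{x}^n\}_{n\ge 0}$ be the sequence generated by the divide-and-conquer (DAC) iteration from an arbitrary initial $\boldsymbol{x}^0\in\mathbb{R}^N$.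 If $R$ is chosen so that $$\delta_R:=\frac{D_1(\mathcal{G})\, d(\mathcal{G})!\, L^2 (2m)^{d(\mathcal{G})}}{c(L-c)\,|\ln(1-c/L)|^{d(\mathcal{G})}}\,(R+2)^{d(\mathcal{G})}\Big(1-\frac{c}{L}\Big)^{R/(2m)}<1,$$ then $\{\boldsymbol{x}^n\}_{n\ge0}$ converges to $\hat{\boldsymbol{x}}$ exponentially in $\ell^p$ for every $1\le p\le\infty$, with convergence rate $\delta_R$: $$\|\boldsymbol{x}^n-\hat{\boldsymbol{x}}\|_p\le (\delta_R)^n\,\|\boldsymbol{x}^0-\hat{\boldsymbol{x}}\|_p,\qquad n\ge 0.$$
   Context: Graph. The geodesic distance $\rho(i,j)$ between vertices $i,j\in V$ is the number of edges in a shortest path connecting $i$ and $j$; $B(i,R)=\{j\in V:\rho(i,j)\le R\}$ for $R\ge 0$. The graph has polynomial growth with constants $d(\mathcal{G})$ (Beurling dimension) and $D_1(\mathcal{G})$ (Beurling density), meaning that $d(\mathcal{G}),D_1(\mathcal{G})>0$ and $\#B(i,R)\le D_1(\mathcal{G})(R+1)^{d(\mathcal{G})}$ for all $i\in V$ and $R\ge 0$. For a possibly non-integer $d>0$, $d!$ means $\Gamma(d+1)$. For $A,B\subset V$, $\rho(A,B)=\inf_{i\in A,j\in B}\rho(i,j)$ (with $\inf\emptyset=+\infty$). Matrices. A matrix on $\mathcal{G}$ is $\mathbf{A}=(a(i,j))_{i,j\in V}$; its geodesic-width $\omega(\mathbf{A})$ is the smallest nonnegative integer such that $a(i,j)=0$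 whenever $\rho(i,j)>\omega(\mathbf{A})$. Positive (semi-)definite matrices are understood to be real symmetric, and $\mathbf{A}\preceq\mathbf{B}$ means that $\mathbf{B}-\mathbf{A}$ is positive semi-definite. $\mathbf{I}$ is the identity matrix. $\|\cdot\|_p$ is the standard $\ell^p$ norm on vectors indexed by $V$, and $\mathbb{R}^N$ is identified with $\mathbb{R}^{V}$. Vertex sets. $\Lambda\subset V$ is a set of vertices (fusion centers). Governing vertex sets are sets $D_\lambda\subset V$, $\lambda\in\Lambda$, with $\bigcup_{\lambda\in\Lambda}D_\lambda=V$ and $D_\lambda\cap D_{\lambda'}=\emptyset$ for distinct $\lambda,\lambda'\in\Lambda$. Extended $R$-neighbors are sets $D_{\lambda,R}\subset V$ with $D_\lambda\subset D_{\lambda,R}$ and $\rho(D_\lambda,V\setminus D_{\lambda,R})>R$ for all $\lambda\in\Lambda$. Selection maps. For $W\subset V$, $\chi_W:\mathbb{R}^{\#V}\to\mathbb{R}^{\#W}$ is $\chi_W\boldsymbol{x}=(x(i))_{i\in W}$; its adjoint $\chi_W^*:\mathbb{R}^{\#W}\to\mathbb{R}^{\#V}$ extends a vector by zero outside $W$; and $\mathbf{I}_W=\chi_W^*\chi_W$. DAC iteration. Starting from $\boldsymbol{x}^0\in\mathbb{R}^N$, for $n\ge 0$: $$\boldsymbol{w}_\lambda^n=\arg\min_{\boldsymbol{u}\in\mathbb{R}^{\#D_{\lambda,R}}}F\big(\chi^*_{D_{\lambda,R}}\boldsymbol{u}+\mathbf{I}_{V\setminus D_{\lambda,R}}\boldsymbol{x}^n\big),\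 \lambda\in\Lambda,\qquad \boldsymbol{x}^{n+1}=\sum_{\lambda\in\Lambda}\mathbf{I}_{D_\lambda}\chi^*_{D_{\lambda,R}}\boldsymbol{w}_\lambda^n.$$ *)

(* Defs.v *)
From HB Require Import structures.
From mathcomp Require Import all_boot all_order all_algebra.
From mathcomp Require Import all_classical all_reals all_analysis.
Set Implicit Arguments.
Unset Strict Implicit.
Unset Printing Implicit Defensive.
Import Order.TTheory GRing.Theory Num.Theory.
Import numFieldNormedType.Exports.
Local Open Scope ring_scope.

(* Loops are harmless: they affect neither connectivity nor distances. *)
Record connected_graph (V : finType) := ConnectedGraph {
  edge :> rel V;
  edge_sym : symmetric edge;
  edge_connected : forall i j, connect edge i j
}.

Section Graph.
Variables (V : finType) (G : connected_graph V).

Definition has_path (i j : V) (n : nat) : bool :=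
  [exists p : n.-tuple V, path G i p && (last i p == j)].

Lemma has_path_ex i j : exists n, has_path i j n.
Proof.
have /connectP[p Gp jE] := edge_connected G i j.
exists (size p); apply/existsP; exists (in_tuple p) => /=.
by rewrite Gp jE eqxx.
Qed.

Definition gdist (i j : V) : nat := ex_minn (has_path_ex i j).

Definition gball (R : realType) (i : V) (r : R) : {set V} :=
  [set j | (gdist i j)%:R <= r]%SET.

Definition set_gdist (R : realType) (A B : {set V}) : \bar R :=
  ereal_inf [set y | exists i j,
    [/\ i \in A, j \in B & y = (gdist i j)%:R%:E]]%classic.

Definition polynomial_growth (R : realType) (d D1 : R) : Prop :=
  [/\ 0 < d, 0 < D1 &
      forall i (r : R), 0 <= r -> #|gball i r|%:R <= D1 * (r + 1) `^ d].

End Graph.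

(* Vectors and matrices indexed by V are column vectors and square matrices of
   size #|V|, through the bijection enum_rank : V -> 'I_#|V|. *)
Definition vcoord (R : realType) (V : finType) (x : 'cV[R]_#|V|) (i : V) : R :=
  x (enum_rank i) ord0.

Definition mcoord (R : realType) (V : finType) (A : 'M[R]_#|V|) (i j : V) : R :=
  A (enum_rank i) (enum_rank j).

Section Width.
Variables (R : realType) (V : finType) (G : connected_graph V).

Definition width_le (A : 'M[R]_#|V|) (w : nat) : bool :=
  [forall i, forall j, (w < gdist G i j)%N ==> (mcoord A i j == 0)].

Lemma width_le_ex A : exists w, width_le A w.
Proof.
exists (\max_i \max_j gdist G i j)%N.
apply/forallP => i; apply/forallP => j; apply/implyP.
rewrite ltnNge => /negP[].
exact: leq_trans (leq_bigmax (F := gdist G i) j)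
  (leq_bigmax (F := fun i => \max_j gdist G i j)%N i).
Qed.

Definition geodesic_width (A : 'M[R]_#|V|) : nat := ex_minn (width_le_ex A).

End Width.

Definition posdefmx (R : realType) n (A : 'M[R]_n) : Prop :=
  A^T = A /\ forall x : 'cV[R]_n, x != 0 -> 0 < (x^T *m A *m x) ord0 ord0.

Definition possemidefmx (R : realType) n (A : 'M[R]_n) : Prop :=
  A^T = A /\ forall x : 'cV[R]_n, 0 <= (x^T *m A *m x) ord0 ord0.

Definition loewner_le (R : realType) n (A B : 'M[R]_n) : Prop :=
  possemidefmx (B - A).

Definition gradient (R : realType) n (f : 'cV[R]_n -> R) (x : 'cV[R]_n) :
    'cV[R]_n :=
  \col_k 'D_(delta_mx k ord0) (f : _ -> R^o) x.

Definition continuously_differentiable (R : realType) n (f : 'cV[R]_n -> R) :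
    Prop :=
  (forall x, differentiable (f : _ -> R^o) x) /\ continuous (gradient f).

Definition depends_only_on (R : realType) (V : finType) (B : {set V})
    (f : 'cV[R]_#|V| -> R) : Prop :=
  forall x y, (forall j, j \in B -> vcoord x j = vcoord y j) -> f x = f y.

Definition is_argmin (R : realType) (T : Type) (f : T -> R) (x : T) : Prop :=
  forall y, f x <= f y.

Definition lpnorm (R : realType) n (p : \bar R) (x : 'cV[R]_n) : R :=
  match p with
  | q%:E => (\sum_k `|x k ord0| `^ q) `^ q^-1
  | +oo%E => \big[Num.max/0]_k `|x k ord0|
  | -oo%E => 0
  end.

(* d! for real d > 0, that is, Gamma (d + 1) *)
Definition factR (R : realType) (d : R) : R :=
  \int[lebesgue_measure]_(t in `]0, +oo[%classic) (t `^ d * expR (- t)).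

Section DAC.
Variables (R : realType) (V : finType).

(* Matrix of the selection map chi_W; its adjoint is the transpose. *)
Definition selmx (W : {set V}) : 'M[R]_(#|W|, #|V|) :=
  \matrix_(k, l) ((enum_val k : V) == enum_val l)%:R.

Definition idmx_on (W : {set V}) : 'M[R]_#|V| := (selmx W)^T *m selmx W.

Definition governing (Lam : {set V}) (D : V -> {set V}) : Prop :=
  (forall i, exists2 l, l \in Lam & i \in D l) /\
  {in Lam &, forall l l', l != l' -> [disjoint D l & D l']}.

Definition extended_neighbors (G : connected_graph V) (Lam : {set V})
    (D : V -> {set V}) (r : R) (DR : V -> {set V}) : Prop :=
  forall l, l \in Lam ->
    D l \subset DR l /\ (r%:E < set_gdist G R (D l) (~: DR l)%SET)%E.

Definition dac_iteration (F : 'cV[R]_#|V| -> R) (Lam : {set V})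
    (D DR : V -> {set V}) (x : nat -> 'cV[R]_#|V|)
    (w : forall (n : nat) (l : V), 'cV[R]_#|DR l|) : Prop :=
  forall n,
    (forall l, l \in Lam ->
       is_argmin
         (fun u => F ((selmx (DR l))^T *m u + idmx_on (~: DR l)%SET *m x n))
         (w n l)) /\
    x n.+1 = \sum_(l in Lam) idmx_on (D l) *m ((selmx (DR l))^T *m w n l).

End DAC.

Definition dac_rate (R : realType) (d D1 c L : R) (m : nat) (r : R) : R :=
  (D1 * factR d * L ^+ 2 * (2 * m%:R) `^ d)
    / (c * (L - c) * `|ln (1 - c / L)| `^ d)
  * (r + 2) `^ d * (1 - c / L) `^ (r / (2 * m%:R)).

(* Main.v *)
Require Import Defs.
From HB Require Import structures.
From mathcomp Require Import all_boot all_order all_algebra.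
From mathcomp Require Import all_classical all_reals all_analysis.
From mathcomp Require Import measurable_realfun ring lra.
Import Order.TTheory GRing.Theory Num.Theory.
Import numFieldNormedType.Exports.
Local Open Scope ring_scope.

(* If y is the n-th local update extended by x^n outside W = D_{l,R}, then
   z = y - xhat satisfies (Phi z)_k = 0 for k in W and z = x^n - xhat outside W.
   On W, z therefore equals T z for the masked operator T = 1_W (I - Phi / L), a
   contraction of ratio q = 1 - c/L and of width 2m.  Iterating T, the influence
   of z_j (j outside W) on z_i (i in W) is at most
   sum_{k >= rho(i,j)/2m} q^k <= (L/c) q^{rho(i,j)/2m}, and rho(i,j) > R when
   i lies in D_l.  So the error is dominated by a symmetric kernel supported on
   rho > R; its row sums are bounded by delta_R, writing the exponentials as
   integrals and comparing polynomial growth with the Gamma integral, and the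
   Schur test then gives contraction of ratio delta_R in every l^p. *)

(** * Off-diagonal decay for banded positive definite systems *)

Section LocalDecay.
Context {R : realType}.

Definition sqnorm {n} (v : 'cV[R]_n) : R := \sum_k v k 0 ^+ 2.

Lemma sqnormE n (v : 'cV[R]_n) : (v^T *m v) 0 0 = sqnorm v.
Proof. by rewrite mxE; apply: eq_bigr => k _; rewrite mxE expr2. Qed.

Lemma sqnorm_delta n (j : 'I_n) : sqnorm (delta_mx j 0) = 1.
Proof.
rewrite /sqnorm (bigD1 j) //= big1 ?addr0 => [|k kj].
  by rewrite mxE !eqxx expr1n.
by rewrite mxE (negbTE kj) expr0n.
Qed.

Lemma entry_le_sqrt_sqnorm n (v : 'cV[R]_n) k : `|v k 0| <= Num.sqrt (sqnorm v).
Proof.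
rewrite -sqrtr_sqr ler_wsqrtr // /sqnorm (bigD1 k) //= lerDl.
by apply: sumr_ge0 => i _; rewrite sqr_ge0.
Qed.

Lemma quad_le_sqnorm {n} {S : 'M[R]_n} {q : R} (v : 'cV[R]_n) :
  loewner_le S q%:M -> (v^T *m S *m v) 0 0 <= q * sqnorm v.
Proof.
move=> [_ /(_ v)]; rewrite mulmxBr mulmxBl mul_mx_scalar -scalemxAl.
by rewrite mxE [X in X + _]mxE [X in _ + X]mxE sqnormE subr_ge0.
Qed.

(* The form of [S] is nonnegative at [v - S v / q]. *)
Lemma psd_contraction n (S : 'M[R]_n) (q : R) (v : 'cV[R]_n) :
  0 < q -> possemidefmx S -> loewner_le S q%:M ->
  sqnorm (S *m v) <= q ^+ 2 * sqnorm v.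
Proof.
move=> q0 [Ssym Spos] Sq.
have := Spos (v - q^-1 *: (S *m v)).
have -> : ((v - q^-1 *: (S *m v))^T *m S *m (v - q^-1 *: (S *m v))) 0 0 =
  (v^T *m S *m v) 0 0 - 2 * q^-1 * sqnorm (S *m v)
   + q^-1 ^+ 2 * ((S *m v)^T *m S *m (S *m v)) 0 0.
  have vS : v^T *m S = (S *m v)^T by rewrite trmx_mul Ssym.
  have -> : (v - q^-1 *: (S *m v))^T = v^T - q^-1 *: (S *m v)^T.
    by apply/rowP => k; rewrite !mxE.
  rewrite !mulmxBl !mulmxBr vS -!mulmxA -!scalemxAl.
  rewrite -!scalemxAr -sqnormE.
  rewrite !mxE; ring.
have h1 := quad_le_sqnorm v Sq.
have h2 := quad_le_sqnorm (S *m v) Sq.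
move=> h; have {h h1 h2} : 0 <= q * sqnorm v - q^-1 * sqnorm (S *m v).
  apply: le_trans h _.
  have h3 : q^-1 ^+ 2 * ((S *m v)^T *m S *m (S *m v)) 0 0 <=
      q^-1 * sqnorm (S *m v).
    have -> : q^-1 * sqnorm (S *m v) = q^-1 ^+ 2 * (q * sqnorm (S *m v)).
      by field; rewrite gt_eqF.
    by rewrite ler_wpM2l // sqr_ge0.
  lra.
by rewrite subr_ge0 ler_pdivrMl // mulrA -expr2.
Qed.

(** Only rows are masked: the columns outside [W] stay, so that values outside [W] still act as a
    source for the equations on [W]. *)
Definition row_mask {n} (W : pred 'I_n) (S : 'M[R]_n) : 'M[R]_n :=
  \matrix_(k, l) if W k then S k l else 0.

Lemma row_maskE n (W : pred 'I_n) (S : 'M[R]_n) (v : 'cV[R]_n) k :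
  (row_mask W S *m v) k 0 = if W k then (S *m v) k 0 else 0.
Proof.
rewrite !mxE; case: ifP => Wk.
  by apply: eq_bigr => l _; rewrite mxE Wk.
by rewrite big1 // => l _; rewrite mxE Wk mul0r.
Qed.

Lemma sqnorm_row_mask n (W : pred 'I_n) (S : 'M[R]_n) (v : 'cV[R]_n) :
  sqnorm (row_mask W S *m v) <= sqnorm (S *m v).
Proof.
apply: ler_sum => k _; rewrite row_maskE; case: ifP => // _.
by rewrite expr0n sqr_ge0.
Qed.

Lemma iter_mulmx_sum n m (T : 'M[R]_n) (P : pred 'I_m) (a : 'I_m -> R)
    (v : 'I_m -> 'cV[R]_n) N :
  iter N (mulmx T) (\sum_(j | P j) a j *: v j) =
  \sum_(j | P j) a j *: iter N (mulmx T) (v j).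
Proof.
elim: N => //= N ->; rewrite mulmx_sumr.
by apply: eq_bigr => j _; rewrite scalemxAr.
Qed.

(** Substituting the equation into itself gives a truncated Neumann series with remainder. The
    powers of [T] on [g] start at 1 because [g] enters only through [T]. *)
Lemma iter_mulmx_fixpoint n (T : 'M[R]_n) (u g : 'cV[R]_n) :
  u = T *m (u + g) -> forall N,
  u = iter N (mulmx T) u + \sum_(t < N) iter t.+1 (mulmx T) g.
Proof.
move=> uE; elim=> [|N IH]; first by rewrite big_ord0 addr0.
rewrite big_ord_recl /= {1}uE {1}IH !mulmxDr mulmx_sumr -addrA; congr (_ + _).
by rewrite addrC; congr (_ + _); apply: eq_bigr.
Qed.

(** One application of [T] spreads the support by a distance at most [w], so a point source at [j]
    cannot reach beyond distance [w * N] in [N] steps. *)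
Lemma iter_mulmx_local {n} {rho : 'I_n -> 'I_n -> nat} {w : nat}
    {T : 'M[R]_n} :
  (forall k, rho k k = 0%N) ->
  (forall k l h, rho k h <= rho k l + rho l h)%N ->
  (forall k l, (w < rho k l)%N -> T k l = 0) ->
  forall N i j, (w * N < rho i j)%N ->
  iter N (mulmx T) (delta_mx j 0 : 'cV[R]_n) i 0 = 0.
Proof.
move=> rho0 rhoD Tloc; elim=> [|N IH] i j hij.
  rewrite mxE; case: eqP => // ij.
  by move: hij; rewrite ij rho0.
rewrite /= mxE big1 // => l _.
have [hl|hl] := ltnP w (rho i l); first by rewrite Tloc // mul0r.
rewrite IH ?mulr0 // -(ltn_add2l w) -mulnS.
by apply: (leq_trans hij); apply: (leq_trans (rhoD i l j)); rewrite leq_add2r.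
Qed.

(** Only exponents at least [a] contribute, so the sum is dominated by a geometric tail. The power
    is real because [a] will be a quotient of a distance by the width. *)
Lemma geometric_tail_le (q a : R) (b : pred nat) N : 0 < q -> q < 1 ->
  (forall t, b t -> a <= t%:R) ->
  \sum_(t < N | b t.+1) q ^+ t.+1 <= (1 - q)^-1 * q `^ a.
Proof.
move=> q0 q1 ba.
have q'0 : 0 < 1 - q by rewrite subr_gt0.
rewrite mulrC ler_pdivlMr //.
(* The factor [1 - q] telescopes the sum. The maximum with 0 covers the stage where no index
   satisfies [b] yet and [q ^+ N.+1] may exceed the real power. *)
suff : (\sum_(t < N | b t.+1) q ^+ t.+1) * (1 - q) <=
    Num.max 0 (q `^ a - q ^+ N.+1).
  move/le_trans; apply; rewrite ge_max powR_ge0 /= lerBlDr lerDl.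
  by rewrite exprn_ge0 // ltW.
elim: N => [|N IH]; first by rewrite big_ord0 mul0r le_max lexx.
rewrite big_mkcond big_ord_recr -big_mkcond /= mulrDl.
case: ifP => [/ba aN|_]; last first.
  rewrite mul0r addr0; apply: le_trans IH _.
  rewrite ge_max !le_max lexx /= lerD2l lerN2.
  by apply/orP; right; rewrite [leLHS]exprS ler_piMl ?exprn_ge0 // ltW.
have qa : q ^+ N.+1 <= q `^ a.
  by rewrite -powR_mulrn ?(ltW q0) // ger_powR ?q0 ?(ltW q1).
have {IH} IH : (\sum_(i < N | b i.+1) q ^+ i.+1) * (1 - q) <= q `^ a - q ^+ N.+1.
  by apply: (le_trans IH); rewrite max_r // subr_ge0.
rewrite le_max; apply/orP; right.
rewrite (exprS q N.+1); lra.
Qed.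

Lemma le_of_geometric_slack (q M a b : R) : 0 <= q -> q < 1 ->
  (forall N, a <= q ^+ N * M + b) -> a <= b.
Proof.
move=> q0 q1 h.
have cv : ((fun N => q ^+ N * M + b) @ \oo --> (0 * M + b : R))%classic.
  apply: cvgD; last exact: cvg_cst.
  by apply: cvgMl; apply: cvg_expr; rewrite ger0_norm.
rewrite mul0r add0r in cv.
apply: (ler_cvg_to (cvg_cst a) cv); exact: nearW.
Qed.

(** [S] is the Richardson iteration matrix with step [L^-1]: it maps the spectral interval [c, L] of
    [A] into [0, 1 - c/L]. *)
Lemma loewner_sandwich {n} {A : 'M[R]_n} {c L : R} : 0 < L ->
  loewner_le c%:M A -> loewner_le A L%:M ->
  let S := 1%:M - L^-1 *: A in
  possemidefmx S /\ loewner_le S (1 - c / L)%:M.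
Proof.
move=> L0 [symc hc] [symL hL] S.
have scale a (B : 'M[R]_n) : 0 <= a -> possemidefmx B -> possemidefmx (a *: B).
  move=> a0 [Bs Bp]; split; first by rewrite linearZ /= Bs.
  by move=> v; rewrite -scalemxAr -scalemxAl mxE mulr_ge0.
have Li0 : 0 <= L^-1 by rewrite invr_ge0 ltW.
split.
  have -> : S = L^-1 *: (L%:M - A).
    by rewrite scalerBr scale_scalar_mx mulVf ?gt_eqF.
  exact: scale.
rewrite /loewner_le.
have -> : (1 - c / L)%:M - S = L^-1 *: (A - c%:M).
  by apply/matrixP => i j; rewrite !mxE; case: eqP => _; rewrite ?mulr1n ?mulr0n; ring.
exact: scale.
Qed.

(** The value at [j] outside [W] reaches [i] only after [rho i j / w] steps of a contraction of
    ratio [1 - c / L]. Summing the geometric tail from there yields the prefactor [L / c]. *)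
Lemma local_solution_decay n (rho : 'I_n -> 'I_n -> nat) (w : nat)
    (A : 'M[R]_n) (c L : R) (W : pred 'I_n) (z : 'cV[R]_n) :
  (forall k, rho k k = 0%N) ->
  (forall k l h, rho k h <= rho k l + rho l h)%N ->
  (0 < w)%N -> 0 < c -> c < L ->
  (forall k l, (w < rho k l)%N -> A k l = 0) ->
  loewner_le c%:M A -> loewner_le A L%:M ->
  (forall k, W k -> (A *m z) k 0 = 0) ->
  forall i, W i -> `|z i 0| <=
    \sum_(j | ~~ W j) L / c * (1 - c / L) `^ ((rho i j)%:R / w%:R) * `|z j 0|.
Proof.
move=> rho0 rhoD w0 c0 cL Aloc cA AL Az i Wi.
have L0 : 0 < L by exact: lt_trans cL.
have [Spos Sq] := loewner_sandwich L0 cA AL.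
set S := 1%:M - _ in Spos Sq; set q := 1 - c / L in Sq *.
have q0 : 0 < q by rewrite subr_gt0 ltr_pdivrMr // mul1r.
have q1 : q < 1 by rewrite gtrBl divr_gt0.
pose T := row_mask W S.
have Tloc k l : (w < rho k l)%N -> T k l = 0.
  move=> h; rewrite mxE; case: ifP => // _; rewrite !mxE Aloc // mulr0 subr0.
  by case: eqP => // kl; move: h; rewrite kl rho0.
(* [T] need not be symmetric, so its contraction is inherited from [S]: masking only drops
   coordinates. *)
have Tq N v : sqnorm (iter N (mulmx T) v) <= q ^+ N ^+ 2 * sqnorm v.
  elim: N => [|N IH]; first by rewrite expr0 expr1n mul1r.
  apply: le_trans (sqnorm_row_mask _ _ _ _) _.
  apply: le_trans (psd_contraction _ _ _ _ q0 Spos Sq) _.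
  apply: (@le_trans _ _ (q ^+ 2 * (q ^+ N ^+ 2 * sqnorm v))).
    by rewrite ler_wpM2l // sqr_ge0.
  by rewrite mulrA -exprMn -exprS.
have Tq' N v k : `|iter N (mulmx T) v k 0| <= q ^+ N * Num.sqrt (sqnorm v).
  apply: le_trans (entry_le_sqrt_sqnorm _ _ _) _.
  apply: le_trans (ler_wsqrtr (Tq N v)) _.
  by rewrite sqrtrM ?sqr_ge0 // sqrtr_sqr ger0_norm // exprn_ge0 // ltW.
(* [z] splits into its part [u] on [W] and exterior data [g], written as point sources so that each
   [j] can be followed separately. *)
pose u : 'cV[R]_n := \col_k (if W k then z k 0 else 0).
pose g : 'cV[R]_n := \sum_(j | ~~ W j) z j 0 *: delta_mx j 0.
have zE : z = u + g.
  apply/colP => k; rewrite !mxE summxE; case: ifP => Wk.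
    rewrite big1 ?addr0 // => j /negP Wj; rewrite !mxE; case: eqP => [kj|].
      by rewrite -kj in Wj.
    by rewrite mulr0.
  rewrite add0r (bigD1 k) ?Wk //= !mxE !eqxx mulr1 big1 ?addr0 //.
  by move=> j /andP[_ jk]; rewrite !mxE eq_sym (negbTE jk) mulr0.
(* On [W] the equation [A *m z = 0] says exactly that [S] fixes [z]. *)
have uE : u = T *m (u + g).
  apply/colP => k; rewrite -zE row_maskE [LHS]mxE; case: ifP => // Wk.
  by rewrite /S mulmxBl mul1mx -scalemxAl [RHS]mxE [X in _ + X]mxE
    [X in _ - X]mxE Az // mulr0 subr0.
(* The Neumann remainder is of order [q ^+ N]; it is carried as a slack that vanishes as [N]
   grows. *)
apply: (@le_of_geometric_slack q (Num.sqrt (sqnorm u)) _ _ (ltW q0) q1) => N.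
have -> : z i 0 = u i 0 by rewrite mxE Wi.
rewrite {1}(iter_mulmx_fixpoint _ _ _ _ uE N) mxE.
apply: le_trans (ler_normD _ _) (lerD (Tq' N u i) _).
rewrite summxE; apply: le_trans (ler_norm_sum _ _ _) _.
(* Locality kills the powers too short to join [j] to [i]; the others are bounded by [q ^+ t.+1], a
   point source having norm 1. *)
apply: (@le_trans _ _ (\sum_(t < N) \sum_(j | ~~ W j)
    `|z j 0| * if (rho i j <= w * t.+1)%N then q ^+ t.+1 else 0)).
  apply: ler_sum => t _.
  rewrite iter_mulmx_sum summxE; apply: le_trans (ler_norm_sum _ _ _) _.
  apply: ler_sum => j _; rewrite [X in `|X|]mxE normrM ler_wpM2l //.
  case: leqP => h; last by rewrite (iter_mulmx_local rho0 rhoD Tloc) // normr0.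
  by apply: le_trans (Tq' _ _ _) _; rewrite sqnorm_delta sqrtr1 mulr1.
rewrite exchange_big /=; apply: ler_sum => j _.
rewrite -mulr_sumr mulrC ler_wpM2r // -big_mkcond /=.
have -> : L / c = (1 - q)^-1 by rewrite opprB addrC subrK invf_div.
apply: (geometric_tail_le _ _ (fun t => rho i j <= w * t)%N) => // t h.
by rewrite ler_pdivrMr ?ltr0n // -natrM ler_nat mulnC.
Qed.

End LocalDecay.

(** * Exponential sums under polynomial growth, bounded by the Gamma integral *)

Section GammaSum.
Context {R : realType}.
Let mu := @lebesgue_measure R.

Lemma integral_exp_tail (k b : R) : 0 < k ->
  (\int[mu]_(x in `[b, +oo[) (k * expR (- (k * x)))%:E = (expR (- (k * b)))%:E)%E.
Proof.
move=> k0.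
pose F x := - expR (- (k * x)).
have dF (x : R) : is_derive x 1 F (k * expR (- (k * x))).
  rewrite /F; apply: is_derive_eq.
  by rewrite [k%:A]mulr1 mulrN opprK mulrC.
have cF (x : R) : {for x, continuous F}.
  by apply/differentiable_continuous/derivable1_diffP.
rewrite (@ge0_continuous_FTC2y _ _ F _ 0) //.
- by rewrite -EFinB sub0r opprK.
- by move=> x _; rewrite mulr_ge0 ?expR_ge0 // ltW.
- apply: continuous_subspaceT => x.
  apply: cvgMr; apply: (@continuous_comp _ _ _ (fun x => - (k * x)) expR).
    by apply: cvgN; apply: cvgMr; exact: cvg_id.
  exact: continuous_expR.
- rewrite -oppr0; apply: cvgN.
  rewrite (_ : (fun x => expR (- (k * x))) =
               (fun z => expR (- z)) \o (fun z => k * z)) //.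
  by apply: (@cvg_comp _ _ _ _ _ _ (pinfty_nbhs R)); [exact: gt0_cvgMry|exact: cvgr_expR].
- by apply: cvg_at_right_filter; exact: cF.
- by move=> x _; rewrite derive1E; apply: derive_val.
Qed.

(** This is y <= exp y at y = t/(2d), raised to the power [d]. The rate 1/2 leaves an integrable
    exp(-t/2) after multiplication by exp(-t). *)
Lemma powR_le_expR (d t : R) : 0 < d -> 0 <= t ->
  t `^ d <= (2 * d) `^ d * expR (t / 2).
Proof.
move=> d0 t0.
have d20 : 0 < 2 * d by rewrite mulr_gt0.
have h : t <= 2 * d * expR (t / (2 * d)).
  rewrite -ler_pdivrMl // mulrC; apply: le_trans (expR_ge1Dx _).
  by rewrite lerDr.
have -> : expR (t / 2) = expR (t / (2 * d)) `^ d.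
  by rewrite -expRM; congr expR; field; rewrite gt_eqF.
rewrite -powRM ?expR_ge0 ?(ltW d20) // ge0_ler_powR ?nnegrE ?(ltW d0) //.
by rewrite (le_trans t0).
Qed.

Lemma measurable_gamma (d : R) (D : set R) :
  measurable_fun D (EFin \o (fun t : R => t `^ d * expR (- t))).
Proof.
apply/measurable_EFinP/measurable_funTS/measurable_funM.
  exact: measurable_powR.
by apply: measurableT_comp => //; exact: measurable_expR.
Qed.

Lemma gamma_finite (d : R) : 0 < d ->
  (\int[mu]_(t in `]0%R, +oo[) (t `^ d * expR (- t))%:E < +oo)%E.
Proof.
(* The factor 2 in [C] offsets the [2^-1] that puts the majorant in the form of [integral_exp_tail]
   with rate 1/2. *)
move=> d0; set C := (2 * d) `^ d * 2.
apply: (@le_lt_trans _ _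
    (\int[mu]_(t in `[0%R, +oo[) (C%:E * (2^-1 * expR (- (2^-1 * t)))%:E))%E).
  apply: (@le_trans _ _
      (\int[mu]_(t in `[0%R, +oo[) (t `^ d * expR (- t))%:E)%E).
    apply: ge0_subset_integral => //; first exact: measurable_gamma.
      by move=> t _; rewrite lee_fin mulr_ge0 ?powR_ge0 ?expR_ge0.
    by move=> t /=; rewrite !in_itv /= !andbT => /ltW.
  apply: ge0_le_integral => //.
  - by move=> t _; rewrite lee_fin mulr_ge0 ?powR_ge0 ?expR_ge0.
  - exact: measurable_gamma.
  - apply: measurable_funeM; apply/measurable_EFinP/measurable_funM => //.
    apply: measurableT_comp; first exact: measurable_expR.
    by apply: measurableT_comp => //; exact: measurable_funM.
  - move=> t /=; rewrite in_itv /= andbT => t0.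
    rewrite -EFinM lee_fin /C.
    have e : expR (- (2^-1 * t)) = expR (t / 2) * expR (- t).
      by rewrite -expRD; congr expR; lra.
    rewrite e mulrA (_ : _ * 2 * 2^-1 = (2 * d) `^ d); last by field.
    by rewrite mulrA ler_wpM2r ?expR_ge0 // powR_le_expR.
rewrite ge0_integralZl_EFin //.
- by rewrite integral_exp_tail // -EFinM ltry.
- apply/measurable_EFinP/measurable_funM => //.
  apply: measurableT_comp; first exact: measurable_expR.
  by apply: measurableT_comp => //; exact: measurable_funM.
- by rewrite /C mulr_ge0 ?powR_ge0.
Qed.

(** The real integral is [fine] of the extended one, and [fine] sends +oo to 0; [gamma_finite]
    excludes that case. *)
Lemma factRE (d : R) : 0 < d ->
  ((factR d)%:E = \int[mu]_(t in `]0%R, +oo[) (t `^ d * expR (- t))%:E)%E.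
Proof.
move=> d0; rewrite /factR /Rintegral fineK // ge0_fin_numE ?gamma_finite //.
by apply: integral_ge0 => t _; rewrite lee_fin mulr_ge0 ?powR_ge0 ?expR_ge0.
Qed.

Lemma factR_ge0 (d : R) : 0 <= factR d.
Proof. by apply: Rintegral_ge0 => t _; rewrite mulr_ge0 ?powR_ge0 ?expR_ge0. Qed.

(* [expR (- s j)] is the integral of [expR (- u)] over [s j, +oo[, so the sum
   is the integral of [expR (- u)] against the counting function of [s]. *)
Lemma sum_expRN_le_factR (I : finType) (P : pred I) (s : I -> R) (d K : R) :
  0 < d -> 0 <= K -> (forall j, P j -> 0 < s j) ->
  (forall u, 0 < u -> #|[pred j | P j & s j <= u]|%:R <= K * u `^ d) ->
  \sum_(j | P j) expR (- s j) <= K * factR d.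
Proof.
move=> d0 K0 s0 hK.
rewrite -lee_fin EFinM factRE // -ge0_integralZl_EFin //; last 2 first.
- by move=> t _; rewrite lee_fin mulr_ge0 ?powR_ge0 ?expR_ge0.
- exact: measurable_gamma.
pose f j u : \bar R := (expR (- u) * \1_(`[s j, +oo[%classic) u)%:E.
have mf j D : measurable_fun D (f j).
  apply/measurable_EFinP/measurable_funTS/measurable_funM.
    by apply: measurableT_comp => //; exact: measurable_expR.
  exact: measurable_indic.
have f0 j u : (0 <= f j u)%E by rewrite lee_fin mulr_ge0 ?expR_ge0.
have -> : (\sum_(j | P j) expR (- s j))%:E =
    (\int[mu]_(u in `]0%R, +oo[) (\sum_(j <- enum P) f j u)%E)%E.
  rewrite ge0_integral_sum //; last by move=> j; exact: mf.
  rewrite -sumEFin big_enum_cond /=.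
  apply: eq_big => [j|j Pj]; first by rewrite andbT.
  rewrite (_ : f j = (EFin \o (fun u => expR (- u))) \_ (`[s j, +oo[%classic)).
    rewrite -integral_mkcondr.
    rewrite (_ : (_ `&` _)%classic = `[s j, +oo[%classic).
      have := integral_exp_tail 1 (s j) ltr01; rewrite mul1r => <-.
      by apply: eq_integral => u _; rewrite !mul1r.
    apply/seteqP; split => u /=; rewrite !in_itv /= !andbT; first by case.
    by move=> su; split=> //; apply: lt_le_trans su; apply: s0.
  by rewrite epatch_indic; apply/funext => u; rewrite /f EFinM.
apply: ge0_le_integral => //.
- by move=> u _; apply: sume_ge0.
- by apply: emeasurable_sum => j; exact: mf.
- by apply: measurable_funeM; exact: measurable_gamma.
move=> u /=; rewrite in_itv /= andbT => u0.
rewrite /f sumEFin -EFinM lee_fin -mulr_sumr mulrCA mulrC mulrA ler_wpM2r ?expR_ge0 //.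
rewrite mulrC; apply: le_trans (hK u u0).
rewrite big_enum_cond /= -sum1_card natr_sum /= [leRHS]big_mkcond [leLHS]big_mkcond.
apply: ler_sum => j _; rewrite andbT inE (_ : (j \in P) = P j) //.
case: (P j) => //=; rewrite indicE; case: ifP => [_|/negP su].
  by case: (_ \in _).
by rewrite memNset //= in_itv /= andbT.
Qed.

(* With the distances scaled by [t] and shifted by [t * (r - 1)], nothing is
   counted at [u < t], while at [u >= t] the growth bound
   [(u / t + r) `^ d] is at most [((r + 1) * (u / t)) `^ d]. *)
Lemma exp_growth_sum (I : finType) (rho : I -> nat) (d D1 r t : R) :
  0 < d -> 0 < D1 -> 1 <= r -> 0 < t ->
  (forall s : R, 0 <= s -> #|[pred j | (rho j)%:R <= s]|%:R <= D1 * (s + 1) `^ d) ->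
  \sum_(j | r < (rho j)%:R) expR (- (t * (rho j)%:R)) <=
  expR t * expR (- (t * r)) * (D1 * (r + 1) `^ d / t `^ d * factR d).
Proof.
move=> d0 D0 r1 t0 growth.
pose s j := t * (rho j)%:R - t * (r - 1).
have -> : \sum_(j | r < (rho j)%:R) expR (- (t * (rho j)%:R)) =
    expR t * expR (- (t * r)) * \sum_(j | r < (rho j)%:R) expR (- s j).
  rewrite mulr_sumr; apply: eq_bigr => j _; rewrite -!expRD /s; congr expR; ring.
rewrite ler_wpM2l ?mulr_ge0 ?expR_ge0 //.
apply: sum_expRN_le_factR => //.
- by rewrite divr_ge0 ?mulr_ge0 ?powR_ge0 ?(ltW D0).
- move=> j rj; rewrite /s -mulrBr mulr_gt0 // subr_gt0 (lt_trans _ rj) //.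
  by rewrite gtrBl.
move=> u u0.
have sE j : (s j <= u) = ((rho j)%:R <= u / t + (r - 1)).
  rewrite /s lerBlDr -ler_pdivlMl // mulrDr mulrA mulVf ?gt_eqF // mul1r.
  by rewrite mulrC.
have r10 : 0 < r + 1 by rewrite (lt_le_trans ltr01) // lerDr (le_trans ler01).
have [ut|tu] := ltP u t.
  rewrite eq_card0 ?mulr_ge0 ?powR_ge0 ?invr_ge0 ?powR_ge0 ?(ltW D0) // => j.
  rewrite !inE sE; apply/negP => /andP[rj].
  have : u / t < 1 by rewrite ltr_pdivrMr // mul1r.
  lra.
have ut1 : 1 <= u / t by rewrite ler_pdivlMr // mul1r.
apply: (@le_trans _ _ (D1 * (u / t + (r - 1) + 1) `^ d)).
  apply: le_trans (growth _ _); last by lra.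
  rewrite ler_nat; apply: subset_leq_card; apply/fintype.subsetP => j.
  by rewrite !inE sE => /andP[].
rewrite -!mulrA ler_wpM2l ?(ltW D0) //.
have -> : (t `^ d)^-1 * u `^ d = (u / t) `^ d.
  rewrite powRM ?invr_ge0 ?(ltW u0) ?(ltW t0) // mulrC; congr (_ * _).
  by rewrite -powRN -[t^-1]powR_inv1 ?(ltW t0) // -powRrM mulN1r.
have ut0 : 0 <= u / t by rewrite (le_trans ler01).
rewrite -powRM ?(ltW r10) // ge0_ler_powR ?nnegrE ?(ltW d0) //.
- by lra.
- by rewrite mulr_ge0 // ltW.
- by nra.
Qed.
End GammaSum.

(** * Schur test in every lp norm *)

Section SchurTest.
Context {R : realType}.

(** Convexity of the [p]-th power: its graph lies above the tangent at [y]. It follows from Young's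
    inequality for [x] and y^(p-1). *)
Lemma powR_tangent (p x y : R) : 1 <= p -> 0 <= x -> 0 <= y ->
  p * (y `^ (p - 1) * x) <= x `^ p + (p - 1) * y `^ p.
Proof.
move=> p1 x0 y0.
(* At [p = 1] the conjugate exponent p/(p-1) degenerates. *)
have [->|pn1] := eqVneq p 1; first by rewrite subrr powRr0 powRr1 // !mul1r mul0r addr0.
have {p1 pn1} p1 : 1 < p by rewrite lt_def pn1.
have p0 : 0 < p by exact: lt_trans p1.
have pm0 : 0 < p - 1 by rewrite subr_gt0.
have h : p^-1 + (p / (p - 1))^-1 = 1 by field; rewrite !gt_eqF.
have := conjugate_powR x0 (powR_ge0 y (p - 1)) p0 (divr_gt0 p0 pm0) h.
rewrite -powRrM (_ : (p - 1) * (p / (p - 1)) = p); last by field; rewrite gt_eqF.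
rewrite -(ler_pM2l p0) [x * _]mulrC => /le_trans; apply.
rewrite le_eqVlt; apply/orP; left; apply/eqP; field.
by rewrite !gt_eqF.
Qed.

(* Summing the tangent inequality at the weighted mean [(\sum_j k j a j) / del]. *)
Lemma powR_weighted_mean {I : finType} (k a : I -> R) (del p : R) :
  1 <= p -> 0 < del -> (forall j, 0 <= k j) -> (forall j, 0 <= a j) ->
  \sum_j k j <= del ->
  del * ((\sum_j k j * a j) / del) `^ p <= \sum_j k j * a j `^ p.
Proof.
move=> p1 del0 k0 a0 kdel.
set S := \sum_j k j * a j; set M := S / del.
have M0 : 0 <= M.
  by rewrite divr_ge0 ?(ltW del0) //; apply: sumr_ge0 => j _; rewrite mulr_ge0.
have p0 : 0 < p by rewrite (lt_le_trans ltr01).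
have h : p * (M `^ (p - 1) * S) <=
    \sum_j k j * a j `^ p + (p - 1) * (del * M `^ p).
  rewrite /S !mulr_sumr.
  apply: (@le_trans _ _ (\sum_j (k j * a j `^ p + (p - 1) * (k j * M `^ p)))).
    apply: ler_sum => j _.
    have := ler_wpM2l (k0 j) (powR_tangent _ _ _ p1 (a0 j) M0).
    by congr (_ <= _); ring.
  rewrite big_split /= lerD2l -mulr_sumr -mulr_suml.
  by rewrite ler_wpM2l ?subr_ge0 // ler_wpM2r // powR_ge0.
have e : M `^ (p - 1) * S = del * M `^ p.
  rewrite -(mulr_powRB1 M0 p0) mulrA [RHS]mulrC; congr (_ * _).
  by rewrite /M mulrC divfK // gt_eqF.
rewrite e in h; lra.
Qed.

Lemma lpnorm_ge0 n (p : \bar R) (v : 'cV[R]_n) : 0 <= lpnorm p v.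
Proof.
case: p => //= [q|]; first exact: powR_ge0.
by elim/big_ind: _ => // x y x0 y0; rewrite le_max x0.
Qed.

(** For finite [p], the row sums give a power-mean bound at each [i]; summing over [i] and
    exchanging the sums brings in the column sums. For [p = +oo] the row sums bound each entry
    directly. *)
Lemma lpnorm_schur_gt0 n (K : 'I_n -> 'I_n -> R) (del : R) (p : \bar R)
    (a b : 'cV[R]_n) :
  (1 <= p)%E -> 0 < del -> (forall i j, 0 <= K i j) ->
  (forall i, \sum_j K i j <= del) -> (forall j, \sum_i K i j <= del) ->
  (forall i, `|b i 0| <= \sum_j K i j * `|a j 0|) ->
  lpnorm p b <= del * lpnorm p a.
Proof.
move=> p1 del0 K0 row col bK; have dge0 := ltW del0.
case: p p1 => [p | _ | //]; last first.
  have max_ge0 := lpnorm_ge0 _ +oo%E a.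
  rewrite /lpnorm; elim/big_ind: _ => [|x y xm ym|i _].
  - by rewrite mulr_ge0.
  - by rewrite ge_max xm.
  apply: le_trans (bK i) _.
  apply: (@le_trans _ _ (\sum_j K i j * \big[Num.max/0]_k `|a k 0|)).
    apply: ler_sum => j _; rewrite ler_wpM2l //.
    exact: (le_bigmax _ (fun k => `|a k 0|)).
  by rewrite -mulr_suml ler_wpM2r.
rewrite lee_fin => p1; have p0 : 0 < p by rewrite (lt_le_trans ltr01).
have S0 (v : 'cV[R]_n) : 0 <= \sum_k `|v k 0| `^ p.
  by apply: sumr_ge0 => k _; rewrite powR_ge0.
(* [del] is rewritten as the [p]-th root of its [p]-th power, so that the outer roots drop by
   monotonicity. *)
rewrite /lpnorm -[X in X * _](powRr1 dge0) -[X in del `^ X](divff (lt0r_neq0 p0)).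
rewrite powRrM -powRM ?powR_ge0 // ge0_ler_powR ?invr_ge0 ?nnegrE ?(ltW p0) //.
  by rewrite mulr_ge0 // powR_ge0.
have h i : del * (`|b i 0| / del) `^ p <= \sum_j K i j * `|a j 0| `^ p.
  apply: le_trans (powR_weighted_mean _ _ _ _ p1 del0 (K0 i) _ (row i)) => //.
  rewrite ler_wpM2l // ge0_ler_powR ?nnegrE ?(ltW p0) //.
  - by rewrite divr_ge0.
  - by rewrite divr_ge0 //; apply: sumr_ge0 => j _; rewrite mulr_ge0.
  - by rewrite ler_wpM2r // invr_ge0.
have {}h : del * \sum_i (`|b i 0| / del) `^ p <= del * \sum_j `|a j 0| `^ p.
  rewrite mulr_sumr; apply: le_trans (ler_sum _ (fun i _ => h i)) _.
  rewrite exchange_big /= mulr_sumr; apply: ler_sum => j _.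
  by rewrite -mulr_suml ler_wpM2r // powR_ge0.
rewrite ler_pM2l // in h.
apply: le_trans (ler_wpM2l (powR_ge0 del p) h).
rewrite mulr_sumr le_eqVlt; apply/orP; left; apply/eqP.
apply: eq_bigr => i _; rewrite -powRM ?divr_ge0 //.
by rewrite mulrC divfK // gt_eqF.
Qed.

(** The power-mean argument divides by [del]. Enlarging [del] by an arbitrarily small [t] also
    reaches [del = 0], which suits a rate known only to be nonnegative. *)
Lemma lpnorm_schur n (K : 'I_n -> 'I_n -> R) (del : R) (p : \bar R)
    (a b : 'cV[R]_n) :
  (1 <= p)%E -> 0 <= del -> (forall i j, 0 <= K i j) ->
  (forall i, \sum_j K i j <= del) -> (forall j, \sum_i K i j <= del) ->
  (forall i, `|b i 0| <= \sum_j K i j * `|a j 0|) ->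
  lpnorm p b <= del * lpnorm p a.
Proof.
move=> p1 del0 K0 row col bK; apply/ler_addgt0Pr => e e0.
have N0 := lpnorm_ge0 _ p a.
have N1 : 0 < lpnorm p a + 1 by rewrite ltr_wpDl.
pose t := e / (lpnorm p a + 1).
have t0 : 0 < t by rewrite divr_gt0.
apply: (@le_trans _ _ ((del + t) * lpnorm p a)).
  apply: (lpnorm_schur_gt0 _ K) => // [||].
  - by rewrite ltr_wpDl.
  - by move=> i; rewrite (le_trans (row i)) // lerDl ltW.
  - by move=> i; rewrite (le_trans (col i)) // lerDl ltW.
rewrite mulrDl lerD2l /t -mulrA ler_piMr ?(ltW e0) //.
by rewrite mulrC ler_pdivrMr // mul1r lerDl.
Qed.
End SchurTest.

(** * The geodesic distance is a metric; supports and widths in terms of it *)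

Section GraphDistance.
Context {V : finType} (G : connected_graph V).

Lemma has_pathP i j n :
  reflect (exists p, [/\ path G i p, last i p = j & size p = n]) (has_path G i j n).
Proof.
apply: (iffP existsP) => [[p /andP[Gp /eqP pj]]|[p [Gp pj /eqP pn]]].
  by exists p; rewrite size_tuple.
by exists (Tuple pn); rewrite Gp pj eqxx.
Qed.

Lemma gdist_path i j : has_path G i j (gdist G i j).
Proof. by rewrite /gdist; case: ex_minnP. Qed.

Lemma gdist_min i j n : has_path G i j n -> (gdist G i j <= n)%N.
Proof. by rewrite /gdist; case: ex_minnP => k _; apply. Qed.

Lemma gdistxx i : gdist G i i = 0%N.
Proof.
apply/eqP; rewrite -leqn0; apply: gdist_min.
by apply/has_pathP; exists [::].
Qed.

Lemma gdist_triangle i j k : (gdist G i k <= gdist G i j + gdist G j k)%N.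
Proof.
have /has_pathP[p [Gp pj <-]] := gdist_path i j.
have /has_pathP[s [Gs sk <-]] := gdist_path j k.
apply: gdist_min; apply/has_pathP; exists (p ++ s).
by rewrite cat_path last_cat size_cat pj Gp Gs sk.
Qed.

Lemma gdist_le_sym i j : (gdist G i j <= gdist G j i)%N.
Proof.
have /has_pathP[p [Gp pi <-]] := gdist_path j i.
(* A path lists the vertices after its start, so the reversed walk from [i] omits [i] and ends with
   [j]. *)
apply: gdist_min; apply/has_pathP; exists (rev (belast j p)).
rewrite -pi rev_path size_rev size_belast; split => //.
  by rewrite (eq_path (e' := G)) // => x y /=; rewrite edge_sym.
by case: (p) => //= x s; rewrite rev_cons last_rcons.
Qed.

Lemma gdistC i j : gdist G i j = gdist G j i.
Proof. by apply/eqP; rewrite eqn_leq !gdist_le_sym. Qed.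

Lemma gdist_gt_extended {R : realType} {Lam D} {r : R} {DR l i j} :
  extended_neighbors G Lam D r DR -> l \in Lam -> i \in D l -> j \notin DR l ->
  r < (gdist G i j)%:R.
Proof.
move=> ext lL iD jD; have [_] := ext l lL.
rewrite -lte_fin => /lt_le_trans; apply; apply: ereal_inf_lbound.
by exists i, j; rewrite inE.
Qed.

Lemma geodesic_width_eq0 {R : realType} {A : 'M[R]_#|V|} {w k l} :
  (geodesic_width G A <= w)%N ->
  (w < gdist G (enum_val k) (enum_val l))%N -> A k l = 0.
Proof.
rewrite /geodesic_width; case: ex_minnP => u /forallP hu _ uw wd.
have /forallP/(_ (enum_val l))/implyP := hu (enum_val k).
by move=> /(_ (leq_ltn_trans uw wd)) /eqP; rewrite /mcoord !enum_valK.
Qed.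
End GraphDistance.

(** * Coordinates of the selection maps *)

Section Selection.
Context {R : realType} {V : finType}.

Lemma idmx_onE (W : {set V}) (v : 'cV[R]_#|V|) k :
  (idmx_on R W *m v) k 0 = if enum_val k \in W then v k 0 else 0.
Proof.
rewrite /idmx_on -mulmxA mxE.
case: ifP => kW; last first.
  rewrite big1 // => h _; rewrite !mxE; case: eqP => [e|]; last by rewrite mul0r.
  by rewrite -e enum_valP in kW.
have [h0 h0E] : exists h0 : 'I_#|W|, enum_val h0 = enum_val k.
  by exists (enum_rank_in kW (enum_val k)); rewrite enum_rankK_in.
rewrite (bigD1 h0) //= big1 ?addr0 => [|h hh0].
  rewrite !mxE h0E eqxx mul1r (bigD1 k) //= big1 ?addr0 => [|l lk].
    by rewrite mxE h0E eqxx mul1r.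
  by rewrite mxE h0E (inj_eq enum_val_inj) eq_sym (negbTE lk) mul0r.
rewrite !mxE -h0E (inj_eq enum_val_inj) (negbTE hh0).
by rewrite mul0r.
Qed.

Lemma selmxT_out (W : {set V}) (u : 'cV[R]_#|W|) k :
  enum_val k \notin W -> ((selmx R W)^T *m u) k 0 = 0.
Proof.
move=> kW; rewrite mxE big1 // => h _; rewrite !mxE.
by case: eqP => [e|]; [rewrite -e enum_valP in kW | rewrite mul0r].
Qed.
End Selection.

(** * First-order conditions for global and local minimizers *)

Section FirstOrder.
Context {R : realType}.

(** Restriction to a line reduces to one-variable calculus. Minimality is asked along that line
    alone, which serves both the global minimizer and minimizers over the coordinates in [W]. *)
Lemma derive_min_eq0 n (F : 'cV[R]_n -> R) (y v : 'cV[R]_n) :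
  (forall x, differentiable (F : _ -> R^o) x) ->
  (forall h : R, F y <= F (h *: v + y)) -> 'D_v (F : _ -> R^o) y = 0.
Proof.
move=> dF ymin; pose phi (h : R) : R := F (h *: v + y).
have quotE (t : R) :
    (fun h : R => h^-1 *: ((phi : R -> R^o) (h *: (1 : R) + t) - phi t)) =
    (fun h : R => h^-1 *: ((F : _ -> R^o) (h *: v + (t *: v + y)) - F (t *: v + y))).
  by apply/funext => h; rewrite /phi [h *: (1 : R)]mulr1 scalerDl addrA.
have dphi t : derivable (phi : R -> R^o) t 1.
  by rewrite /derivable quotE; apply/diff_derivable/dF.
have min0 : phi 0 = F y by rewrite /phi scale0r add0r.
have /= [_ <-] : is_derive (0 : R) 1 (phi : R -> R^o) 0.
  apply: (@derive1_at_min _ phi (-1) 1 0) => //.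
  - by rewrite in_itv /= ltrN10 ltr01.
  - by move=> t _; rewrite min0; exact: ymin.
by rewrite /derive quotE scale0r add0r.
Qed.

Lemma argmin_gradient_eq0 n (F : 'cV[R]_n -> R) (y : 'cV[R]_n) :
  (forall x, differentiable (F : _ -> R^o) x) -> is_argmin F y -> gradient F y = 0.
Proof.
by move=> dF ymin; apply/colP => k; rewrite !mxE; apply: derive_min_eq0.
Qed.

Lemma local_argmin_gradient_eq0 {V : finType} (F : 'cV[R]_#|V| -> R)
    (W : {set V}) (u : 'cV[R]_#|W|) (g : 'cV[R]_#|V|) k :
  (forall x, differentiable (F : _ -> R^o) x) ->
  is_argmin (fun u => F ((selmx R W)^T *m u + g)) u -> enum_val k \in W ->
  gradient F ((selmx R W)^T *m u + g) k 0 = 0.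
Proof.
move=> dF umin kW; rewrite mxE; apply: derive_min_eq0 => // h.
(* This variation of [u] moves the embedded point by exactly [h *: delta_mx k 0], since [idmx_on]
   fixes that basis vector for [k] in [W]. *)
have := umin (h *: (selmx R W *m delta_mx k 0) + u).
rewrite mulmxDr -addrA -scalemxAr mulmxA.
have -> // : (selmx R W)^T *m selmx R W *m (delta_mx k 0 : 'cV[R]__) = delta_mx k 0.
apply/colP => l; rewrite -/(idmx_on R W) idmx_onE.
case: ifP => // lW; rewrite mxE; case: eqP => // lk.
by rewrite lk kW in lW.
Qed.
End FirstOrder.

(** * The error kernel of one DAC step and its row sums *)

Section DacStep.
Context {R : realType} {V : finType} (G : connected_graph V).

(** Cutting at distance [r], rather than at the boundary of [DR l], makes the kernel symmetric and
    independent of [l]. *)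
Definition dac_kernel (c L r : R) (m : nat) (i j : 'I_#|V|) : R :=
  if r < (gdist G (enum_val i) (enum_val j))%:R
  then L / c * (1 - c / L) `^ ((gdist G (enum_val i) (enum_val j))%:R / (2 * m%:R))
  else 0.

Lemma dac_kernelC (c L r : R) m i j :
  dac_kernel c L r m i j = dac_kernel c L r m j i.
Proof. by rewrite /dac_kernel gdistC. Qed.

Lemma dac_kernel_ge0 (c L r : R) m i j :
  0 < c -> c < L -> 0 <= dac_kernel c L r m i j.
Proof.
move=> c0 cL; rewrite /dac_kernel; case: ifP => // _.
by rewrite mulr_ge0 ?powR_ge0 // divr_ge0 // ltW // (lt_trans c0).
Qed.

Lemma dac_rate_ge0 (d D1 c L r : R) m :
  0 < D1 -> 0 < c -> c < L -> 0 <= dac_rate d D1 c L m r.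
Proof.
move=> D10 c0 cL.
rewrite /dac_rate !mulr_ge0 ?invr_ge0 ?mulr_ge0 ?powR_ge0 ?sqr_ge0 ?factR_ge0
  ?subr_ge0 ?(ltW D10) ?(ltW c0) ?(ltW cL) //;
  exact: ltW (lt_trans c0 cL).
Qed.

Lemma dac_kernel_row_sum (d D1 c L r : R) (m : nat) i :
  polynomial_growth G d D1 -> (0 < m)%N -> 0 < c -> c < L -> 1 <= r ->
  \sum_j dac_kernel c L r m i j <= dac_rate d D1 c L m r.
Proof.
move=> [d0 D10 growth] m0 c0 cL r1.
have L0 : 0 < L by exact: lt_trans cL.
have q0 : 0 < 1 - c / L by rewrite subr_gt0 ltr_pdivrMr // mul1r.
have q1 : 1 - c / L < 1 by rewrite gtrBl divr_gt0.
set q := 1 - c / L in q0 q1 *.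
have lnq : ln q < 0 by rewrite ln_lt0 // q0.
have m20 : 0 < 2 * m%:R :> R by rewrite mulr_gt0 // ltr0n.
(* The rate for which q^(s/(2m)) = exp(-t s). *)
pose t := - ln q / (2 * m%:R).
have t0 : 0 < t by rewrite divr_gt0 // oppr_gt0.
have qE s : q `^ (s / (2 * m%:R)) = expR (- (t * s)).
  by rewrite /powR gt_eqF //; congr expR; rewrite /t; ring.
pose rho (j : 'I_#|V|) := gdist G (enum_val i) (enum_val j).
have -> : \sum_j dac_kernel c L r m i j =
    L / c * \sum_(j | r < (rho j)%:R) expR (- (t * (rho j)%:R)).
  rewrite mulr_sumr [RHS]big_mkcond /=; apply: eq_bigr => j _.
  by rewrite /dac_kernel -/(rho j) -/q qE.
have gr (s : R) : 0 <= s -> #|[pred j | (rho j)%:R <= s]|%:R <= D1 * (s + 1) `^ d.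
  move=> s0; apply: le_trans (growth (enum_val i) s s0).
  rewrite ler_nat -(card_imset _ enum_val_inj); apply: subset_leq_card.
  by apply/fintype.subsetP => _ /imsetP[j + ->]; rewrite !inE.
have Lc0 : 0 <= L / c by rewrite divr_ge0 // ltW.
apply: le_trans (ler_wpM2l Lc0 (exp_growth_sum _ _ _ _ _ _ d0 D10 r1 t0 gr)) _.
(* Here exp t = q^(-1/(2m)) is at most 1/q because 2m >= 1; this produces the factor L - c in the
   denominator of the rate. *)
have et : expR t <= L / (L - c).
  have -> : L / (L - c) = expR (- ln q).
    rewrite expRN lnK ?posrE // /q; field.
    by rewrite !gt_eqF // subr_gt0.
  rewrite ler_expR /t ler_pdivrMr // ler_peMr //.
    by rewrite oppr_ge0 ltW.
  by rewrite -natrM ler1n muln_gt0.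
have Lmc : 0 < L - c by rewrite subr_gt0.
have td : t `^ d = `|ln q| `^ d / (2 * m%:R) `^ d.
  rewrite /t [LHS]powRM ?oppr_ge0 ?invr_ge0 ?(ltW lnq) ?(ltW m20) // ltr0_norm //.
  by rewrite -(powR_inv1 (ltW m20)) -powRrM mulN1r powRN.
(* The rate is the bound already obtained, with exp t enlarged to L/(L-c) and [r + 1] to [r + 2]. *)
have -> : dac_rate d D1 c L m r = L / c * (L / (L - c) * expR (- (t * r)) *
    (D1 * (r + 2) `^ d / t `^ d * factR d)).
  rewrite /dac_rate -/q qE td; field.
  by rewrite !gt_eqF ?powR_gt0 // normr_gt0 lt_eqF.
rewrite ler_wpM2l // ler_pM ?mulr_ge0 ?expR_ge0 ?invr_ge0 ?powR_ge0 ?factR_ge0 //.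
- exact: ltW.
- by rewrite ler_wpM2r ?expR_ge0.
- rewrite ler_wpM2r ?factR_ge0 // ler_wpM2r ?invr_ge0 ?powR_ge0 //.
  rewrite ler_wpM2l ?(ltW D10) // ge0_ler_powR ?nnegrE ?(ltW d0) //; by lra.
Qed.

Lemma dac_step_le {m : nat} {F : 'cV[R]_#|V| -> R}
    {c L : R} {Phi : 'cV[R]_#|V| -> 'cV[R]_#|V| -> 'M[R]_#|V|}
    {xhat : 'cV[R]_#|V|} {r : R} {Lam : {set V}} {D DR : V -> {set V}}
    {x : nat -> 'cV[R]_#|V|} {w : forall (n : nat) (l : V), 'cV[R]_#|DR l|} :
  (0 < m)%N -> (forall y, differentiable (F : _ -> R^o) y) ->
  0 < c -> c < L ->
  (forall y z, (geodesic_width G (Phi y z) <= 2 * m)%N) ->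
  (forall y z, loewner_le c%:M (Phi y z)) ->
  (forall y z, loewner_le (Phi y z) L%:M) ->
  (forall y z, gradient F y - gradient F z = Phi y z *m (y - z)) ->
  is_argmin F xhat -> governing Lam D -> extended_neighbors G Lam D r DR ->
  dac_iteration F Lam D x w ->
  forall n i, `|(x n.+1 - xhat) i 0| <=
    \sum_j dac_kernel c L r m i j * `|(x n - xhat) j 0|.
Proof.
move=> m0 dF c0 cL wid Pc PL FPhi xmin [cover disj] ext dac n i.
have [l lL iD] := cover (enum_val i).
have [DDR _] := ext l lL; have iW := fintype.subsetP DDR _ iD.
have [/(_ l lL) wmin xS] := dac n.
set y := (selmx R (DR l))^T *m w n l + idmx_on R (~: DR l) *m x n.
pose W : pred 'I_#|V| := fun k => enum_val k \in DR l.
(* [F] has zero gradient at [xhat], and at [y] in the coordinates of [W], so the gradient difference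
   vanishes on [W]. *)
have Phi0 k : W k -> (Phi y xhat *m (y - xhat)) k 0 = 0.
  move=> kW; rewrite -FPhi (argmin_gradient_eq0 _ _ _ dF xmin) subr0.
  exact: local_argmin_gradient_eq0.
have yout k : ~~ W k -> (y - xhat) k 0 = (x n - xhat) k 0.
  move=> kW; rewrite [LHS]mxE [RHS]mxE; congr (_ + _).
  by rewrite [LHS]mxE selmxT_out // idmx_onE inE kW add0r.
(* By disjointness of the governing sets, only the summand [l] contributes at [i]. *)
have -> : (x n.+1 - xhat) i 0 = (y - xhat) i 0.
  suff e : x n.+1 i 0 = y i 0 by rewrite mxE e [RHS]mxE.
  rewrite xS summxE (bigD1 l) //= idmx_onE iD big1 ?addr0 => [|l' /andP[l'L l'l]].
    by rewrite [RHS]mxE idmx_onE inE iW addr0.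
  rewrite idmx_onE; case: ifP => // iD'.
  by have /pred0P/(_ (enum_val i)) := disj l' l l'L lL l'l; rewrite /= iD iD'.
apply: le_trans (local_solution_decay _
  (fun j k => gdist G (enum_val j) (enum_val k)) (2 * m) _ c L W _ _ _ _ c0 cL _
  (Pc y xhat) (PL y xhat) Phi0 i iW) _ => //.
- by move=> k; exact: gdistxx.
- by move=> j k h; exact: gdist_triangle.
- by rewrite muln_gt0.
- by move=> j k; exact: geodesic_width_eq0.
(* A vertex outside [DR l] is farther than [r] from [i], so its decay factor is the kernel entry;
   the remaining entries only add nonnegative terms. *)
rewrite big_mkcond; apply: ler_sum => j _; case: ifP => jW; last first.
  by rewrite mulr_ge0 // dac_kernel_ge0.
rewrite yout // /dac_kernel (gdist_gt_extended _ ext lL iD jW) natrM.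
exact: lexx.
Qed.
End DacStep.

(** * Iteration of the one-step contraction *)

Theorem theorem4p1 (R : realType) (V : finType) (G : connected_graph V)
    (d D1 : R) (m : nat) (f : V -> 'cV[R]_#|V| -> R) (F : 'cV[R]_#|V| -> R)
    (c L : R) (Phi : 'cV[R]_#|V| -> 'cV[R]_#|V| -> 'M[R]_#|V|)
    (xhat : 'cV[R]_#|V|) (r : R) (Lam : {set V}) (D DR : V -> {set V})
    (x : nat -> 'cV[R]_#|V|) (w : forall (n : nat) (l : V), 'cV[R]_#|DR l|)
    (V_gt0 : (0 < #|V|)%N)
    (growth : polynomial_growth G d D1)
    (m_gt0 : (0 < m)%N)
    (f_C1 : forall i, continuously_differentiable (f i))
    (f_local : forall i, depends_only_on (gball G i (m%:R : R)) (f i))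
    (F_def : forall y, F y = \sum_i f i y)
    (c_gt0 : 0 < c) (c_lt_L : c < L)
    (Phi_pos : forall y z, posdefmx (Phi y z))
    (Phi_width : forall y z, (geodesic_width G (Phi y z) <= 2 * m)%N)
    (Phi_ge : forall y z, loewner_le c%:M (Phi y z))
    (Phi_le : forall y z, loewner_le (Phi y z) L%:M)
    (F_Phi : forall y z, gradient F y - gradient F z = Phi y z *m (y - z))
    (xhat_min : is_argmin F xhat)
    (r_ge1 : 1 <= r)
    (D_gov : governing Lam D)
    (DR_ext : extended_neighbors G Lam D r DR)
    (x_dac : dac_iteration F Lam D x w)
    (rate_lt1 : dac_rate d D1 c L m r < 1)
    (p : \bar R) (p_ge1 : (1 <= p)%E) :
  (lpnorm p (x n - xhat) @[n --> \oo] --> (0 : R))%classic /\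
  forall n, lpnorm p (x n - xhat)
            <= dac_rate d D1 c L m r ^+ n * lpnorm p (x 0%N - xhat).
Proof.
have dF y : differentiable (F : _ -> R^o) y.
  have -> : F = \sum_i (f i : 'cV[R]_#|V| -> R^o).
    by apply/funext => z; rewrite F_def fct_sumE.
  elim/big_ind: _ => [|g h dg dh|i _]; first exact: differentiable_cst.
    exact: differentiableD.
  by have [] := f_C1 i.
set del := dac_rate d D1 c L m r in rate_lt1 *.
have del0 : 0 <= del by apply: dac_rate_ge0 => //; case: growth.
have rows i : \sum_j dac_kernel G c L r m i j <= del by exact: dac_kernel_row_sum.
have step n : lpnorm p (x n.+1 - xhat) <= del * lpnorm p (x n - xhat).
  apply: (lpnorm_schur _ (dac_kernel G c L r m)) => // [i j|j|].
  - exact: dac_kernel_ge0.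
  (* Symmetry of the kernel turns column sums into row sums. *)
  - by under eq_bigr do rewrite dac_kernelC.
  - exact: (dac_step_le G m_gt0 dF c_gt0 c_lt_L Phi_width Phi_ge Phi_le F_Phi
      xhat_min D_gov DR_ext x_dac).
have bound n : lpnorm p (x n - xhat) <= del ^+ n * lpnorm p (x 0%N - xhat).
  elim: n => [|n IH]; first by rewrite expr0 mul1r.
  by rewrite exprS -mulrA (le_trans (step n)) // ler_wpM2l.
split=> //.
have cv : ((fun n => del ^+ n * lpnorm p (x 0%N - xhat)) @ \oo --> (0 : R))%classic.
  rewrite -[X in (_ --> X)%classic](mul0r (lpnorm p (x 0%N - xhat))).
  by apply: cvgMl; apply: cvg_expr; rewrite ger0_norm.
apply: (squeeze_cvgr _ (cvg_cst 0) cv).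
by apply: nearW => n; rewrite lpnorm_ge0 bound.
Qed.
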